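(* Let $H$ be a bialgebra over a field $K$ and let $A$ be an $H$-module-algebra with action map $\lambda$. Then $(\mathcal{F}^\bullet(A), d)$, as defined in the context, is a cochain complex, i.e. $d^{n+1}\circ d^n = 0$ for all $n \geq 0$.
   Context: Fix a field $K$; $\otimes$ and $\mathrm{Hom}$ are over $K$. $(H,\mu_H,\Delta_H)$ is a $K$-bialgebra; Sweedler notation $\Delta_H(x)=\sum_{(x)} x_{(1)}\otimes x_{(2)}$. $\mathrm{End}(A)$ is the algebra of $K$-linear endomorphisms of $A$ under composition. An associative $K$-algebra $A$ is an $H$-module-algebra if it has an $H$-module structure $\lambda\in\mathrm{Hom}(H,\mathrm{End}(A))$ with $\lambda(xy)=\lambda(x)\circ\lambda(y)$ and $\lambda(x)(ab)=\sum_{(x)}\lambda(x_{(1)})(a)\cdot\lambda(x_{(2)})(b)$ for $x,y\in H$, $a,b\in A$. $\mathrm{Der}(A)$ is the space of linear $\varphi: A\to A$ with $\varphi(ab)=a\varphi(b)+\varphi(a)b$. Deformation complex: $\mathcal{F}^0(A)=\mathrm{Der}(A)$, $\mathcal{F}^1(A)=\mathrm{Hom}(H,\mathrm{End}(A))$, and for $n\ge 2$, $\mathcal{F}^n(A)=\mathcal{F}^n_0(A)\oplus\mathcal{F}^n_1(A)$ with $\mathcal{F}^n_0(A)=\mathrm{Hom}(H^{\otimes n},\mathrm{End}(A))$ and $\mathcal{F}^n_1(A)=\mathrm{Hom}(H,\mathrm{Hom}(A^{\otimes n},A))$. Differentials: for $\varphi\in\mathrm{Der}(A)$, $(d^0\varphi)(x)=\lambda(x)\circ\varphi-\varphi\circ\lambda(x)$.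 For $n\ge 1$, $d^n=(d^n_0;d^n_1)$, i.e. $d^n(\varphi_0;\varphi_1)=(d^n_0\varphi_0;d^n_1\varphi_1)$, where for $n=1$ one sets $\mathcal{F}^1_0=\mathcal{F}^1_1=\mathcal{F}^1(A)$ and $\varphi_0=\varphi_1=\varphi$, so $d^1\varphi=(d^1_0\varphi;d^1_1\varphi)$. Here $$(d^n_0\varphi_0)(x_1\otimes\cdots\otimes x_{n+1})=\lambda(x_1)\circ\varphi_0(x_2\otimes\cdots\otimes x_{n+1})+\sum_{i=1}^n(-1)^i\varphi_0(x_1\otimes\cdots\otimes x_ix_{i+1}\otimes\cdots\otimes x_{n+1})+(-1)^{n+1}\varphi_0(x_1\otimes\cdots\otimes x_n)\circ\lambda(x_{n+1})$$ (the Hochschild coboundary of $H$ with coefficients in the $H$-bimodule $\mathrm{End}(A)$, $x\otimes f\otimes y\mapsto\lambda(x)\circ f\circ\lambda(y)$), and $$(d^n_1\varphi_1)(x)(a_1\otimes\cdots\otimes a_{n+1})=\sum_{(x)}\lambda(x_{(1)})(a_1)\cdot\varphi_1(x_{(2)})(a_2\otimes\cdots\otimes a_{n+1})+\sum_{i=1}^n(-1)^i\varphi_1(x)(a_1\otimes\cdots\otimes a_ia_{i+1}\otimes\cdots\otimes a_{n+1})+(-1)^{n+1}\sum_{(x)}\varphi_1(x_{(1)})(a_1\otimes\cdots\otimes a_n)\cdot\lambda(x_{(2)})(a_{n+1}).$$ *)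

(* Defs.v *)
From HB Require Import structures.
From mathcomp Require Import all_boot all_algebra.
From mathcomp Require Import boolp zify.
From mathcomp.multinomials Require Import freeg.
(* freeg shadows fintype.lift *)
From mathcomp Require Import fintype.

Set Implicit Arguments.
Unset Strict Implicit.
Unset Printing Implicit Defensive.

Import GRing.Theory.
Local Open Scope ring_scope.
Local Open Scope quotient_scope.

Section Hom.
Variables (K : fieldType) (U V : lmodType K).
Implicit Types (f g h : {linear U -> V}) (a b : K).

Lemma linear_ext f g : f =1 g -> f = g.
Proof.
case: f g => [f cf] [g cg] /= /funext fg; subst g; congr GRing.Linear.Pack.
case: cf cg => [[a] [b]] [[a'] [b']].
by rewrite (Prop_irrelevance a a') (Prop_irrelevance b b').
Qed.

Definition mk_linear (f : U -> V) (lf : linear f) : {linear U -> V} :=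
  HB.pack f (GRing.isLinear.Build K U V *:%R f lf).

Definition lin_add f g : {linear U -> V} := f \+ g.
Definition lin_opp f : {linear U -> V} := \- f.
Definition lin_zero : {linear U -> V} := \0.
Definition lin_scale a f : {linear U -> V} := a \*: f.

HB.instance Definition _ := gen_eqMixin {linear U -> V}.
HB.instance Definition _ := gen_choiceMixin {linear U -> V}.

Lemma lin_addA : associative lin_add.
Proof. by move=> f g h; apply: linear_ext => x /=; rewrite addrA. Qed.
Lemma lin_addC : commutative lin_add.
Proof. by move=> f g; apply: linear_ext => x /=; rewrite addrC. Qed.
Lemma lin_add0 : left_id lin_zero lin_add.
Proof. by move=> f; apply: linear_ext => x /=; rewrite add0r. Qed.
Lemma lin_addN : left_inverse lin_zero lin_opp lin_add.
Proof. by move=> f; apply: linear_ext => x /=; rewrite addNr. Qed.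

HB.instance Definition _ := GRing.isZmodule.Build {linear U -> V}
  lin_addA lin_addC lin_add0 lin_addN.

Lemma lin_scaleA a b f : lin_scale a (lin_scale b f) = lin_scale (a * b) f.
Proof. by apply: linear_ext => x /=; rewrite scalerA. Qed.
Lemma lin_scale1 : left_id 1 lin_scale.
Proof. by move=> f; apply: linear_ext => x /=; rewrite scale1r. Qed.
Lemma lin_scaleDr : right_distributive lin_scale +%R.
Proof. by move=> a f g; apply: linear_ext => x /=; rewrite scalerDr. Qed.
Lemma lin_scaleDl f : {morph lin_scale^~ f : a b / a + b}.
Proof. by move=> a b; apply: linear_ext => x /=; rewrite scalerDl. Qed.

HB.instance Definition _ := GRing.Zmodule_isLmodule.Build K {linear U -> V}
  lin_scaleA lin_scale1 lin_scaleDr lin_scaleDl.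

Lemma lin_addE f g x : (f + g) x = f x + g x. Proof. by []. Qed.
Lemma lin_oppE f x : (- f) x = - f x. Proof. by []. Qed.
Lemma lin_zeroE x : (0 : {linear U -> V}) x = 0. Proof. by []. Qed.
Lemma lin_scaleE a f x : (a *: f) x = a *: f x. Proof. by []. Qed.

Definition linE := (lin_addE, lin_oppE, lin_zeroE, lin_scaleE).

End Hom.

Definition lin_comp (K : fieldType) (U V W : lmodType K)
  (g : {linear V -> W}) (f : {linear U -> V}) : {linear U -> W} := g \o f.

Lemma lin_comp_bilinear (K : fieldType) (U V W : lmodType K) :
  bilinear_for *:%R *:%R (@lin_comp K U V W).
Proof.
split=> [f a g g'|g a f f']; apply: linear_ext => x; first by [].
by rewrite /= linearP.
Qed.

Definition upd (V : Type) n (x : V ^ n) (i : 'I_n) (v : V) : V ^ n :=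
  [ffun j => if j == i then v else x j].

Definition multilinear (K : fieldType) (V W : lmodType K) n
    (f : V ^ n -> W) : Prop :=
  forall i x a u v, f (upd x i (a *: u + v)) = a *: f (upd x i u) + f (upd x i v).

(* The tensor power V^{(x) n} is the quotient of the vector space freely
   generated by V ^ n by the subspace spanned by the multilinearity relators,
   that is, by the intersection of all subspaces containing them. *)
Section TensorPower.
Variables (K : fieldType) (V : lmodType K) (n : nat).

Definition tfree : lmodType K := {freeg (V ^ n) / K}.

Definition relator (i : 'I_n) (x : V ^ n) (a : K) (u v : V) : tfree :=
  << upd x i (a *: u + v) >> - a *: << upd x i u >> - << upd x i v >>.

Definition tnull : {pred tfree} := fun t =>
  `[< forall S : {pred tfree}, GRing.submod_closed S ->
        (forall i x a u v, relator i x a u v \in S) -> t \in S >].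

Lemma tnull_submod : GRing.submod_closed tnull.
Proof.
split=> [|a t u /asboolP tN /asboolP uN]; apply/asboolP => S Ssub Srel.
  by case: (Ssub).
by case: (Ssub) => _; apply; [apply: tN | apply: uN].
Qed.

HB.instance Definition _ := GRing.isSubmodClosed.Build K tfree tnull tnull_submod.

Definition tpow := Quotient.quot (tnull : zmodClosed tfree).

HB.instance Definition _ := GRing.Zmodule.on tpow.

Definition tpi (t : tfree) : tpow := \pi_tpow t.
Definition trepr (t : tpow) : tfree := repr t.

Lemma treprK : cancel trepr tpi. Proof. exact: reprK. Qed.

Lemma tpi_eqP t u : reflect (tpi t = tpi u) (t - u \in tnull).
Proof.
have -> : (t - u \in tnull) = (tpi t == tpi u).
  exact: (Quotient.idealrBE (tnull : zmodClosed tfree)).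
exact: eqP.
Qed.

Lemma tpiD : {morph tpi : t u / t + u}.
Proof. by move=> t u; rewrite /tpi raddfD. Qed.

Definition tscale (a : K) (t : tpow) : tpow := tpi (a *: trepr t).

Lemma tpiZ a : {morph tpi : t / a *: t >-> tscale a t}.
Proof.
by move=> t; apply/tpi_eqP; rewrite -scalerBr; apply/rpredZ/tpi_eqP; rewrite treprK.
Qed.

Lemma tscaleA a b t : tscale a (tscale b t) = tscale (a * b) t.
Proof. by rewrite -[t]treprK -!tpiZ scalerA. Qed.
Lemma tscale1 : left_id 1 tscale.
Proof. by move=> t; rewrite -[t]treprK -tpiZ scale1r. Qed.
Lemma tscaleDr : right_distributive tscale +%R.
Proof. by move=> a t u; rewrite -[t]treprK -[u]treprK -tpiD -!tpiZ scalerDr tpiD. Qed.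
Lemma tscaleDl t : {morph tscale^~ t : a b / a + b}.
Proof. by move=> a b; rewrite -[t]treprK -!tpiZ scalerDl tpiD. Qed.

HB.instance Definition _ := GRing.Zmodule_isLmodule.Build K tpow
  tscaleA tscale1 tscaleDr tscaleDl.

Lemma tpi_is_linear : linear tpi.
Proof. by move=> a t u; rewrite tpiD tpiZ. Qed.

HB.instance Definition _ := GRing.isLinear.Build K tfree tpow *:%R tpi
  tpi_is_linear.

Definition tpure (x : V ^ n) : tpow := tpi << x >>.

Lemma tpure_multilinear : multilinear tpure.
Proof.
move=> i x a u v; rewrite /tpure -linearP; apply/tpi_eqP.
apply/asboolP => S _ Srel; have := Srel i x a u v.
by rewrite /relator opprD addrA.
Qed.

Lemma tpow_ext (W : lmodType K) (f g : {linear tpow -> W}) :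
  (forall x, f (tpure x) = g (tpure x)) -> f = g.
Proof.
move=> fg; apply: linear_ext => t; rewrite -[t]treprK -[trepr t]freeg_sumE.
rewrite !linear_sum; apply: eq_bigr => x _.
have -> : << coeff x (trepr t) *g x >> = coeff x (trepr t) *: << x >> :> tfree.
  by apply/eqP/freeg_eqP => y; rewrite coeffZ !coeffU mul1r.
by rewrite !linearZ; congr (_ *: _); exact: fg.
Qed.

(* The linear map on the tensor power induced by the multilinear map f.  It is
   defined for every f by choosing a representative, but has a meaning only
   when f is multilinear, in which case it does not depend on that choice. *)
Definition tlift (W : lmodType K) (f : V ^ n -> W) (t : tpow) : W :=
  fglift f (trepr t).

Section Lift.
Variables (W : lmodType K) (f : V ^ n -> W).

Lemma fglift_is_zmod : zmod_morphism (fglift f : tfree -> W).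
Proof. exact: lift_is_additive. Qed.

Definition fgadditive : {additive tfree -> W} :=
  HB.pack (fglift f) (GRing.isZmodMorphism.Build tfree W (fglift f) fglift_is_zmod).

Lemma fglift_is_linear : linear (fglift f : tfree -> W).
Proof.
move=> a t u; rewrite -![fglift f _]/(fgadditive _) raddfD; congr (_ + _).
rewrite -[X in _ = _ *: fgadditive X]freeg_sumE [a *: t]/(fgscale a t) /fgscale.
rewrite (raddf_sum fgadditive) [X in _ = _ *: X](raddf_sum fgadditive).
rewrite scaler_sumr; apply: eq_bigr => x _ /=.
by rewrite !liftU scalerA.
Qed.

Lemma tliftE t : tlift f t = \sum_(x <- dom (trepr t)) coeff x (trepr t) *: f x.
Proof.
rewrite /tlift -{1}[trepr t]freeg_sumE -[fglift f _]/(fgadditive _).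
rewrite (raddf_sum fgadditive).
by apply: eq_bigr => x _; rewrite -liftU.
Qed.

Hypothesis f_mlin : multilinear f.

Lemma tlift_pi t : tlift f (tpi t) = fglift f t.
Proof.
pose g : {linear tfree -> W} := mk_linear fglift_is_linear.
have /asboolP /(_ [pred t | g t == 0]) : trepr (tpi t) - t \in tnull.
  by apply/tpi_eqP; rewrite treprK.
rewrite inE linearB subr_eq0 => /(_ _ _)/eqP; apply=> [|i x a u v].
  split=> [|a u v]; rewrite !inE ?linear0 // => /eqP u0 /eqP v0.
  by rewrite linearP u0 v0 scaler0 addr0.
rewrite inE !linearB linearZ /= !liftU !scale1r f_mlin.
by rewrite -addrA -opprD subrr.
Qed.

Lemma tlift_is_linear : linear (tlift f).
Proof.
move=> a t u; rewrite -[t]treprK -[u]treprK -linearP !tlift_pi.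
exact: fglift_is_linear.
Qed.

Lemma tlift_pure x : tlift f (tpure x) = f x.
Proof. by rewrite tlift_pi liftU scale1r. Qed.

Definition tlin : {linear tpow -> W} := mk_linear tlift_is_linear.

Lemma tlin_pure x : tlin (tpure x) = f x. Proof. exact: tlift_pure. Qed.

End Lift.

Lemma tlift_linear_fun (W : lmodType K) a (f g : V ^ n -> W) t :
  tlift (fun x => a *: f x + g x) t = a *: tlift f t + tlift g t.
Proof.
rewrite !tliftE scaler_sumr -big_split; apply: eq_bigr => x _ /=.
by rewrite scalerDr !scalerA [_ * a]mulrC.
Qed.

End TensorPower.

Definition tens (K : fieldType) (V : lmodType K) n (s : n.-tuple V) : tpow V n :=
  tpure [ffun i => tnth s i].

Definition sweedler (K : fieldType) (V W : lmodType K) (B : V -> V -> W)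
    (t : tpow V 2) : W :=
  tlift (fun p : V ^ 2 => B (p ord0) (p ord_max)) t.

(* \sw_(y, z <- t) E is the sum, over any decomposition of t in V (x) V as a sum
   of pure tensors y (x) z, of the expression E, which must be bilinear in y
   and z. *)
Reserved Notation "\sw_ ( y , z <- t ) E"
  (at level 36, E at level 36, y name, z name, t at level 200,
   format "\sw_ ( y ,  z  <-  t )  E").
Notation "\sw_ ( y , z <- t ) E" := (sweedler (fun y z => E) t) : ring_scope.

(* Associative algebras, not necessarily unital. *)
HB.mixin Record isAssocAlgebra (K : fieldType) A of GRing.Lmodule K A := {
  amul : A -> A -> A;
  amulA : associative amul;
  amul_bilinear : bilinear_for *:%R *:%R amul
}.

#[short(type="assocAlgType")]
HB.structure Definition AssocAlgebra (K : fieldType) :=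
  {A of GRing.Lmodule K A & isAssocAlgebra K A}.

Infix "**" := amul (at level 40, left associativity) : ring_scope.

HB.mixin Record isBialgebra (K : fieldType) H of GRing.Algebra K H := {
  comul : {linear H -> tpow H 2};
  counit : {scalar H};
  comul_coassoc : forall x : H,
    \sw_(y, z <- comul x) \sw_(y1, y2 <- comul y) tens [tuple y1; y2; z] =
    \sw_(y, z <- comul x) \sw_(z1, z2 <- comul z) tens [tuple y; z1; z2];
  comul_counitl : forall x : H, \sw_(y, z <- comul x) (counit y *: z) = x;
  comul_counitr : forall x : H, \sw_(y, z <- comul x) (counit z *: y) = x;
  comul1 : comul 1 = tens [tuple 1; 1];
  comulM : forall x x' : H,
    comul (x * x') =
    \sw_(y, z <- comul x) \sw_(y', z' <- comul x') tens [tuple y * y'; z * z'];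
  counit1 : counit 1 = 1;
  counitM : forall x x' : H, counit (x * x') = counit x * counit x'
}.

#[short(type="bialgType")]
HB.structure Definition Bialgebra (K : fieldType) :=
  {H of GRing.Algebra K H & isBialgebra K H}.

(* No condition on the action of 1 is imposed: only multiplicativity and
   compatibility with the product of A. *)
Record module_algebra (K : fieldType) (H : bialgType K) (A : assocAlgType K) :=
  ModuleAlgebra {
    act :> {linear H -> {linear A -> A}};
    actM : forall x y : H, act (x * y) = lin_comp (act x) (act y);
    act_amul : forall (x : H) (a b : A),
      act x (a ** b) = \sw_(y, z <- comul x) (act y a ** act z b)
  }.

Section Arguments.
Variables (V : Type) (n : nat).
Implicit Types (x : V ^ n.+1).

Definition args_tail x : V ^ n := [ffun i : 'I_n => x (lift ord0 i)].
Definition args_init x : V ^ n := [ffun i : 'I_n => x (widen_ord (leqnSn n) i)].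

(* (x_0, ..., x_n) |-> (x_0, ..., op x_i x_{i+1}, ..., x_n); indices start at 0,
   hence the sign (-1) ^+ i.+1 in the coboundaries below. *)
Definition args_merge (op : V -> V -> V) (i : 'I_n) x : V ^ n :=
  [ffun j : 'I_n =>
     if (j < i)%N then x (widen_ord (leqnSn n) j)
     else if j == i then op (x (widen_ord (leqnSn n) i)) (x (lift ord0 i))
     else x (lift ord0 j)].

End Arguments.

Section Multilinear.
Variables (K : fieldType) (V W : lmodType K).

Lemma mlin_add n (f g : V ^ n -> W) :
  multilinear f -> multilinear g -> multilinear (fun x => f x + g x).
Proof.
by move=> fM gM i x a u v; rewrite fM gM scalerDr addrACA.
Qed.

Lemma mlin_scale n (c : K) (f : V ^ n -> W) :
  multilinear f -> multilinear (fun x => c *: f x).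
Proof.
by move=> fM i x a u v; rewrite fM scalerDr !scalerA [c * a]mulrC.
Qed.

Lemma mlin_sum n I (r : seq I) (F : I -> V ^ n -> W) :
  (forall i, multilinear (F i)) -> multilinear (fun x => \sum_(i <- r) F i x).
Proof.
move=> FM i x a u v; rewrite scaler_sumr -big_split.
by apply: eq_bigr => j _; apply: FM.
Qed.

Lemma mlin_comp n (W' : lmodType K) (f : V ^ n -> W') (g : {linear W' -> W}) :
  multilinear f -> multilinear (fun x => g (f x)).
Proof. by move=> fM i x a u v; rewrite fM linearP. Qed.

Lemma mlin_head n (W' : lmodType K) (B : V -> W' -> W) (f : V ^ n -> W') :
  bilinear_for *:%R *:%R B -> multilinear f ->
  multilinear (fun x : V ^ n.+1 => B (x ord0) (f (args_tail x))).
Proof.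
move=> [Bl Br] fM i x a u v; have [->|[j ->]] : i = ord0 \/ exists j, i = lift ord0 j.
  by case: (unliftP ord0 i) => [j ->|->]; [right; exists j | left].
- have E w : args_tail (upd x ord0 w) = args_tail x.
    by apply/ffunP => k; rewrite !ffunE.
  by rewrite !E !ffunE eqxx; apply: Bl.
- have E w : args_tail (upd x (lift ord0 j) w) = upd (args_tail x) j w.
    by apply/ffunP => k; rewrite !ffunE (inj_eq (lift_inj (h := ord0))).
  by rewrite !E !ffunE /= fM; apply: Br.
Qed.

Lemma mlin_last n (W' : lmodType K) (B : W' -> V -> W) (f : V ^ n -> W') :
  bilinear_for *:%R *:%R B -> multilinear f ->
  multilinear (fun x : V ^ n.+1 => B (f (args_init x)) (x ord_max)).
Proof.
have wE (j : 'I_n) : widen_ord (leqnSn n) j = lift ord_max j.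
  by apply/val_inj; rewrite /= /bump leqNgt ltn_ord.
move=> [Bl Br] fM i x a u v; have [->|[j ->]] : i = ord_max \/ exists j, i = lift ord_max j.
  by case: (unliftP ord_max i) => [j ->|->]; [right; exists j | left].
- have E w : args_init (upd x ord_max w) = args_init x.
    by apply/ffunP => k; rewrite !ffunE wE eq_sym (negbTE (neq_lift _ _)).
  by rewrite !E !ffunE eqxx; apply: Br.
- have E w : args_init (upd x (lift ord_max j) w) = upd (args_init x) j w.
    by apply/ffunP => k; rewrite !ffunE !wE (inj_eq (lift_inj (h := ord_max))).
  by rewrite !E !ffunE (negbTE (neq_lift _ _)) fM; apply: Bl.
Qed.

Lemma mlin_merge n (op : V -> V -> V) (i : 'I_n) (f : V ^ n -> W) :
  bilinear_for *:%R *:%R op -> multilinear f ->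
  multilinear (fun x => f (args_merge op i x)).
Proof.
move=> [opl opr] fM k x a u v.
suff [j [g gL E]] : exists j, exists2 g : V -> V, linear g &
    forall w, args_merge op i (upd x k w) = upd (args_merge op i x) j (g w).
  by rewrite !E gL fM.
have eqI m (p q : 'I_m) : (p == q) = (p == q :> nat) by [].
have liftE (p : 'I_n) : lift ord0 p = p.+1 :> nat by [].
have widE (p : 'I_n) : widen_ord (leqnSn n) p = p :> nat by [].
have [kn0 in0] := (ltn_ord k, ltn_ord i).
have [ki|[ki|[ki|ki]]] : (k < i)%N \/ k = i :> nat \/ k = i.+1 :> nat \/ (i.+1 < k)%N.
- by lia.
- have kn : (k < n)%N by lia.
  exists (Ordinal kn), idfun => // w; apply/ffunP => l; rewrite !ffunE !eqI /= /bump !add1n.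
  by do ![case: ifP => ?] => //; lia.
- exists i, (fun w => op w (x (lift ord0 i))); first exact: opl.
  move=> w; apply/ffunP => l; rewrite !ffunE !eqI !liftE !widE.
  by do ![case: ifP => ?] => //; lia.
- exists i, (fun w => op (x (widen_ord (leqnSn n) i)) w); first exact: opr.
  move=> w; apply/ffunP => l; rewrite !ffunE !eqI !liftE !widE.
  by do ![case: ifP => ?] => //; lia.
- have kn : (k.-1 < n)%N by lia.
  exists (Ordinal kn), idfun => // w; apply/ffunP => l; rewrite !ffunE !eqI /= /bump !add1n.
  by do ![case: ifP => ?] => //; lia.
Qed.

Lemma mlin_tlift n m (V' : lmodType K) (t : tpow V' m)
    (F : V' ^ m -> V ^ n -> W) :
  (forall p, multilinear (F p)) -> multilinear (fun x => tlift (F^~ x) t).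
Proof.
move=> FM i x a u v; rewrite -tlift_linear_fun; congr (tlift _ t).
by apply/funext => p; apply: FM.
Qed.

End Multilinear.

Lemma sweedler_linear_fun (K : fieldType) (V W : lmodType K) a
    (B B' : V -> V -> W) t :
  \sw_(y, z <- t) (a *: B y z + B' y z) =
  a *: (\sw_(y, z <- t) B y z) + \sw_(y, z <- t) B' y z.
Proof. exact: tlift_linear_fun. Qed.

Lemma sweedler_is_linear (K : fieldType) (V W : lmodType K) (B : V -> V -> W) :
  bilinear_for *:%R *:%R B -> linear (sweedler B).
Proof.
move=> [Bl Br]; apply: tlift_is_linear => i p a u v.
have [->|->] : i = ord0 \/ i = ord_max.
  by case: i => [[|[|//]] ?]; [left | right]; apply: val_inj.
- by rewrite !ffunE /=; apply: Bl.
- by rewrite !ffunE /=; apply: Br.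
Qed.

Lemma sweedler_tens (K : fieldType) (V W : lmodType K) (B : V -> V -> W) y z :
  bilinear_for *:%R *:%R B ->
  \sw_(y', z' <- tens [tuple y; z]) B y' z' = B y z.
Proof.
move=> [Bl Br]; rewrite /sweedler /tens tlift_pure ?ffunE // => i p a u v.
have [->|->] : i = ord0 \/ i = ord_max.
  by case: i => [[|[|//]] ?]; [left | right]; apply: val_inj.
- by rewrite !ffunE /=; apply: Bl.
- by rewrite !ffunE /=; apply: Br.
Qed.

Lemma lin_three (K : fieldType) (V : lmodType K) (c s : K) (p q r p' q' r' : V) :
  (c *: p + p') + (c *: q + q') + s *: (c *: r + r') =
  c *: (p + q + s *: r) + (p' + q' + s *: r').
Proof. by rewrite !scalerDr !scalerA [s * c]mulrC (addrACA (c *: p) p') [LHS]addrACA. Qed.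

Lemma lin_sum (K : fieldType) (V : lmodType K) (c : K) n (e : 'I_n -> K)
    (f g : 'I_n -> V) :
  \sum_(i < n) e i *: (c *: f i + g i) =
  c *: (\sum_(i < n) e i *: f i) + \sum_(i < n) e i *: g i.
Proof.
rewrite scaler_sumr -big_split; apply: eq_bigr => i _ /=.
by rewrite scalerDr !scalerA [c * _]mulrC.
Qed.

Lemma coord0_mlin (K : fieldType) (V : lmodType K) :
  multilinear (fun x : V ^ 1 => x ord0).
Proof. by move=> i x a u v; rewrite !ffunE (ord1 i). Qed.

(* The canonical isomorphism from the first tensor power of V to V. *)
Definition tpow1 (K : fieldType) (V : lmodType K) : {linear tpow V 1 -> V} :=
  tlin (@coord0_mlin K V).

Lemma lin_pair_is_linear (K : fieldType) (U V W : lmodType K)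
  (f : {linear U -> V}) (g : {linear U -> W}) : linear (fun u => (f u, g u)).
Proof. by move=> a u v; rewrite !linearP. Qed.

Definition lin_pair (K : fieldType) (U V W : lmodType K)
    (f : {linear U -> V}) (g : {linear U -> W}) :
    {linear U -> (V * W)%type} :=
  mk_linear (lin_pair_is_linear f g).

Section Cochains.
Variables (K : fieldType) (H : bialgType K) (A : assocAlgType K).

Definition is_derivation (phi : {linear A -> A}) : Prop :=
  forall a b, phi (a ** b) = a ** phi b + phi a ** b.

Definition der : {pred {linear A -> A}} := fun phi => `[< is_derivation phi >].

Lemma der_submod : GRing.submod_closed der.
Proof.
have [Ml Mr] := @amul_bilinear K A.
have M0l x : 0 ** x = 0 :> A.
  by have /= := Ml x (-1) 0 0; rewrite scaler0 addr0 scaleN1r addNr.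
have M0r x : x ** 0 = 0 :> A.
  by have /= := Mr x (-1) 0 0; rewrite scaler0 addr0 scaleN1r addNr.
split=> [|c f g /asboolP fD /asboolP gD]; apply/asboolP => a b.
  by rewrite !linE M0l M0r addr0.
by rewrite !linE fD gD scalerDr addrACA; congr (_ + _);
  [rewrite Mr | rewrite Ml].
Qed.

HB.instance Definition _ :=
  GRing.isSubmodClosed.Build K {linear A -> A} der der_submod.

Record Der := MkDer { der_val :> {linear A -> A}; _ : der_val \in der }.

HB.instance Definition _ := [isSub for der_val].
HB.instance Definition _ := [Choice of Der by <:].
HB.instance Definition _ := [SubChoice_isSubZmodule of Der by <:].
HB.instance Definition _ := [SubZmodule_isSubLmodule of Der by <:].

Definition cochain0 n : lmodType K := {linear tpow H n -> {linear A -> A}}.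
Definition cochain1 n : lmodType K := {linear H -> {linear tpow A n -> A}}.

Definition cochain n : lmodType K :=
  match n with
  | 0 => Der
  | 1 => {linear H -> {linear A -> A}}
  | n => (cochain0 n * cochain1 n)%type
  end.

Section Differential.
Variable lambda : module_algebra H A.

Definition dDer_fun (phi : Der) (x : H) : {linear A -> A} :=
  lin_comp (lambda x) phi - lin_comp phi (lambda x).

(* Values of the coboundaries on pure tensors, in their multilinear form. *)
Definition d0_fun n (phi : cochain0 n) (x : H ^ n.+1) : {linear A -> A} :=
  lin_comp (lambda (x ord0)) (phi (tpure (args_tail x)))
  + \sum_(i < n) (-1) ^+ i.+1 *: phi (tpure (args_merge *%R i x))
  + (-1) ^+ n.+1 *: lin_comp (phi (tpure (args_init x))) (lambda (x ord_max)).

Definition d1_fun n (phi : cochain1 n) (x : H) (a : A ^ n.+1) : A :=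
  \sw_(y, z <- comul x) (lambda y (a ord0) ** phi z (tpure (args_tail a)))
  + \sum_(i < n) (-1) ^+ i.+1 *: phi x (tpure (args_merge amul i a))
  + (-1) ^+ n.+1 *:
      \sw_(y, z <- comul x) (phi y (tpure (args_init a)) ** lambda z (a ord_max)).

Lemma dDer_linear_x phi : linear (dDer_fun phi).
Proof.
have [Cl Cr] := @lin_comp_bilinear K A A A.
move=> a x y; rewrite /dDer_fun linearP Cl Cr.
by rewrite opprD addrACA scalerBr.
Qed.

Lemma d0_mlin n (phi : cochain0 n) : multilinear (d0_fun phi).
Proof.
have [Cl Cr] := @lin_comp_bilinear K A A A.
have phiM : multilinear (fun x => phi (tpure x)).
  exact/mlin_comp/tpure_multilinear.
apply: mlin_add; first apply: mlin_add.
- apply: (mlin_head (B := fun y f => lin_comp (lambda y) f)) phiM.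
  by split=> [f a y y'|y a f f']; rewrite ?linearP ?Cl ?Cr.
- apply: mlin_sum => i; apply: mlin_scale.
  apply: mlin_merge phiM; split=> [u a x y|u a x y].
    by rewrite /= mulrDl -scalerAl.
  by rewrite /= mulrDr -scalerAr.
- apply: mlin_scale; apply: (mlin_last (B := fun f y => lin_comp f (lambda y))) phiM.
  by split=> [y a f f'|f a y y']; rewrite ?linearP ?Cl ?Cr.
Qed.

Lemma d1_mlin n (phi : cochain1 n) x : multilinear (d1_fun phi x).
Proof.
have [Ml Mr] := @amul_bilinear K A.
have phiM z : multilinear (fun a => phi z (tpure a)).
  exact/mlin_comp/tpure_multilinear.
apply: mlin_add; first apply: mlin_add.
- apply: mlin_tlift => p.
  apply: (mlin_head (B := fun b c => lambda (p ord0) b ** c)) (phiM _).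
  by split=> [c a b b'|b a c c']; rewrite ?linearP ?Ml ?Mr.
- apply: mlin_sum => i; apply: mlin_scale.
  by apply: mlin_merge (phiM x); apply: amul_bilinear.
- apply: mlin_scale; apply: mlin_tlift => p.
  apply: (mlin_last (B := fun b c => b ** lambda (p ord_max) c)) (phiM _).
  by split=> [c a b b'|b a c c']; rewrite ?linearP ?Ml ?Mr.
Qed.

Definition dDer_lin phi : {linear H -> {linear A -> A}} :=
  mk_linear (dDer_linear_x phi).

Definition d0_lin n (phi : cochain0 n) : cochain0 n.+1 := tlin (d0_mlin phi).

Definition d1_lin_x n (phi : cochain1 n) x : {linear tpow A n.+1 -> A} :=
  tlin (d1_mlin phi x).

Lemma d1_linear_x n (phi : cochain1 n) : linear (d1_lin_x phi).
Proof.
have [Ml Mr] := @amul_bilinear K A.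
move=> c x y; apply: tpow_ext => a; rewrite !linE !tlin_pure /d1_fun.
rewrite linearP !sweedler_is_linear; first last.
- by split=> [z k u v|u k z z'] /=; rewrite linearP linE ?Ml ?Mr.
- by split=> [z k u v|u k z z'] /=; rewrite linearP linE ?Ml ?Mr.
rewrite -lin_three -lin_sum; congr (_ + _ + _).
by apply: eq_bigr => i _; rewrite linearP linE.
Qed.

Definition d1_lin n (phi : cochain1 n) : cochain1 n.+1 :=
  mk_linear (d1_linear_x phi).

Lemma dDer_linear : linear dDer_lin.
Proof.
have [Cl Cr] := @lin_comp_bilinear K A A A.
move=> c f g; apply: linear_ext => x; rewrite linE /= /dDer_fun Cl Cr.
by rewrite opprD addrACA scalerBr.
Qed.

Lemma d0_linear n : linear (@d0_lin n).
Proof.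
have [Cl Cr] := @lin_comp_bilinear K A A A.
move=> c f g; apply: tpow_ext => x; rewrite !linE !tlin_pure /d0_fun.
by rewrite !linE Cl Cr -lin_three -lin_sum.
Qed.

Lemma d1_linear n : linear (@d1_lin n).
Proof.
have [Ml Mr] := @amul_bilinear K A.
move=> c f g; apply: linear_ext => x; apply: tpow_ext => a.
rewrite !linE !tlin_pure /d1_fun.
rewrite -lin_three -lin_sum -!sweedler_linear_fun; congr (_ + _ + _ *: _).
- by congr (sweedler _ _); apply/funext => y; apply/funext => z; rewrite linE Mr.
- by congr (sweedler _ _); apply/funext => y; apply/funext => z; rewrite linE Ml.
Qed.

Definition dDer : {linear Der -> {linear H -> {linear A -> A}}} :=
  mk_linear dDer_linear.
Definition d0 n : {linear cochain0 n -> cochain0 n.+1} := mk_linear (@d0_linear n).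
Definition d1 n : {linear cochain1 n -> cochain1 n.+1} := mk_linear (@d1_linear n).

Lemma cochain1to0_is_linear :
  linear (fun phi : {linear H -> {linear A -> A}} =>
            lin_comp phi (tpow1 H) : cochain0 1).
Proof. by have [Cl _] := @lin_comp_bilinear K (tpow H 1) H {linear A -> A}; apply: Cl. Qed.

Lemma cochain1to1_linear_x (phi : {linear H -> {linear A -> A}}) :
  linear (fun x => lin_comp (phi x) (tpow1 A)).
Proof.
have [Cl _] := @lin_comp_bilinear K (tpow A 1) A A.
by move=> c x y; rewrite linearP Cl.
Qed.

Lemma cochain1to1_is_linear :
  linear (fun phi => mk_linear (cochain1to1_linear_x phi) : cochain1 1).
Proof.
have [Cl _] := @lin_comp_bilinear K (tpow A 1) A A.
by move=> c f g; apply: linear_ext => x; rewrite linE /= Cl.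
Qed.

(* A 1-cochain seen as an element of Hom(H^{(x) 1}, End A), respectively of
   Hom(H, Hom(A^{(x) 1}, A)). *)
Definition cochain1to0 : {linear cochain 1 -> cochain0 1} :=
  mk_linear cochain1to0_is_linear.
Definition cochain1to1 : {linear cochain 1 -> cochain1 1} :=
  mk_linear cochain1to1_is_linear.

Definition diff n : {linear cochain n -> cochain n.+1} :=
  match n with
  | 0 => dDer
  | 1 => lin_pair (lin_comp (d0 1) cochain1to0) (lin_comp (d1 1) cochain1to1)
  | n.+2 => lin_pair (lin_comp (d0 n.+2) (fst : {linear cochain n.+2 -> _}))
                     (lin_comp (d1 n.+2) (snd : {linear cochain n.+2 -> _}))
  end.

End Differential.
End Cochains.

(* Main.v *)
(** Both components of the differential are Hochschild coboundaries attached to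
    a multiplicative map [rho] into an associative algebra [W], regarded as a
    bimodule through [rho].  For [d0] this is [lambda : H -> End A].  For [d1]
    it is the map [A -> Hom(H, A)] sending [a] to [x |-> lambda x a], where
    [Hom(H, A)] carries the convolution product: the compatibility of the action
    with the product of [A] says exactly that this map is multiplicative.  The
    square of the Hochschild coboundary vanishes by the cosimplicial identities.
    In degree 0, [dDer phi] is, as an element of Hom(H^{(x) 1}, End A), the
    coboundary of the 0-cochain [phi]; as a map [A -> Hom(H, A)] it is a
    1-cocycle because [phi] is a derivation. *)
Require Import Defs.
From mathcomp Require Import all_boot all_algebra.
From mathcomp Require Import boolp zify.
Import GRing.Theory.
Local Open Scope ring_scope.

Set Implicit Arguments.
Unset Strict Implicit.
Unset Printing Implicit Defensive.

(** * Cancellation in alternating double sums *)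

(** Here [s j i] stands for the [j]-th coface after the [i]-th. Passing from [n] to [n.+1] adds the
    terms with outer index [n.+1] and those with inner index [n]; these cancel in pairs, as
    [s n.+1 i = s i n] and the signs are opposite. *)
Lemma alternating_double_sum0 (R : pzRingType) (M : lmodType R)
    (s : nat -> nat -> M) (n : nat) :
  (forall i j, (i < j <= n)%N -> s j i = s i j.-1) ->
  \sum_(j < n.+1) (-1) ^+ j *: (\sum_(i < n) (-1) ^+ i *: s j i) = 0.
Proof.
elim: n => [|n IH] s_comm; first by rewrite big_ord1 big_ord0 scaler0.
rewrite big_ord_recr /=.
under eq_bigr => j _ do rewrite big_ord_recr /= scalerDr.
rewrite big_split /= IH ?add0r; last first.
  by move=> i j /andP[ij jn]; apply: s_comm; rewrite ij leqW.
rewrite scaler_sumr -big_split big1 // => i _ /=.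
rewrite (s_comm i n.+1) ?ltn_ord ?leqnn // !scalerA exprS mulN1r mulNr.
by rewrite -!exprD addnC scaleNr subrr.
Qed.

Lemma linear_comb (K : fieldType) (U V : lmodType K) (g : {linear U -> V})
    n (e : 'I_n -> K) (u : 'I_n -> U) :
  g (\sum_(i < n) e i *: u i) = \sum_(i < n) e i *: g (u i).
Proof. by rewrite linear_sum; apply: eq_bigr => i _; rewrite linearZ. Qed.

(** * Hochschild coboundary along a multiplicative map *)

Section Hochschild.
Variables (K : fieldType) (V : Type) (W : lmodType K).
Variables (op : V -> V -> V) (m : W -> W -> W) (rho : V -> W).
Hypotheses (opA : associative op) (mA : associative m).
Hypothesis m_bilinear : bilinear_for *:%R *:%R m.
Hypothesis rhoM : {morph rho : x y / op x y >-> m x y}.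

(** A cochain is a plain function on tuples, meant as the values on pure tensors. The formula has
    the shape of [d0_fun] and [d1_fun], so that it can be matched with them by conversion. *)
Definition hochschild n (f : V ^ n -> W) (x : V ^ n.+1) : W :=
  m (rho (x ord0)) (f (args_tail x))
  + \sum_(i < n) (-1) ^+ i.+1 *: f (args_merge op i x)
  + (-1) ^+ n.+1 *: m (f (args_init x)) (rho (x ord_max)).

(* [args_merge] indexed by a natural number, to make index shifts painless *)
Definition args_merge_nat n (k : nat) (x : V ^ n.+1) : V ^ n :=
  [ffun j : 'I_n =>
     if (j < k)%N then x (widen_ord (leqnSn n) j)
     else if j == k :> nat
     then op (x (widen_ord (leqnSn n) j)) (x (lift ord0 j))
     else x (lift ord0 j)].

Lemma args_mergeE n (i : 'I_n) (x : V ^ n.+1) :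
  args_merge op i x = args_merge_nat i x.
Proof.
apply/ffunP => j; rewrite !ffunE; case: ifP => // _.
by rewrite -(inj_eq val_inj) /=; case: eqP => // /val_inj ->.
Qed.

(** For 0 < [k] <= [n] the arguments at positions [k.-1] and [k] are merged; every [k] above [n]
    gives the last coface. *)
Definition coface n (k : nat) (f : V ^ n -> W) (x : V ^ n.+1) : W :=
  if k == 0%N then m (rho (x ord0)) (f (args_tail x))
  else if (k <= n)%N then f (args_merge_nat k.-1 x)
  else m (f (args_init x)) (rho (x ord_max)).

Lemma hochschildE n (f : V ^ n -> W) x :
  hochschild f x = \sum_(k < n.+2) (-1) ^+ k *: coface k f x.
Proof.
rewrite /hochschild big_ord_recr big_ord_recl /= expr0 scale1r.
congr (_ + _ + _).
  apply: eq_bigr => i _; rewrite args_mergeE /coface /= /bump add1n /=.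
  by rewrite ltn_ord.
by rewrite /coface /= ltnn.
Qed.

Lemma mulm_sumr n w (e : 'I_n -> K) (g : 'I_n -> W) :
  m w (\sum_(i < n) e i *: g i) = \sum_(i < n) e i *: m w (g i).
Proof.
have [_ mr] := m_bilinear.
exact: (linear_comb (mk_linear (mr w))).
Qed.

Lemma mulm_suml n w (e : 'I_n -> K) (g : 'I_n -> W) :
  m (\sum_(i < n) e i *: g i) w = \sum_(i < n) e i *: m (g i) w.
Proof.
have [ml _] := m_bilinear.
exact: (linear_comb (mk_linear (ml w))).
Qed.

Lemma coface_sum n p k (e : 'I_p -> K) (f : 'I_p -> V ^ n -> W) x :
  coface k (fun y => \sum_(i < p) e i *: f i y) x =
  \sum_(i < p) e i *: coface k (f i) x.
Proof.
rewrite /coface; case: eqP => _; first exact: mulm_sumr.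
by case: ifP => _; [| exact: mulm_suml].
Qed.

(** * Commutation of merging and dropping arguments *)

(** Reading entries at natural numbers turns the casts between ordinals into arithmetic for [lia].
    The values are meaningful for [k] <= [n] only, hence the bounds below, and empty tuples are
    treated apart. *)
Let arg n (x : V ^ n.+1) k := x (inord k).

Lemma argE n (x : V ^ n.+1) i : x i = arg x i.
Proof. by rewrite /arg inord_val. Qed.

Lemma arg_tail n (x : V ^ n.+2) k : (k <= n)%N ->
  arg (args_tail x) k = arg x k.+1.
Proof.
move=> kn; rewrite /arg ffunE; congr (x _); apply/val_inj.
by rewrite /= !inordK.
Qed.

Lemma arg_init n (x : V ^ n.+2) k : (k <= n)%N ->
  arg (args_init x) k = arg x k.
Proof.
move=> kn; rewrite /arg ffunE; congr (x _); apply/val_inj.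
by rewrite /= !inordK // leqW.
Qed.

Lemma arg_merge n (x : V ^ n.+2) l k : (k <= n)%N ->
  arg (args_merge_nat l x) k =
  if (k < l)%N then arg x k
  else if k == l then op (arg x k) (arg x k.+1) else arg x k.+1.
Proof.
move=> kn; rewrite /arg ffunE inordK //.
have -> : widen_ord (leqnSn n.+1) (inord k) = inord k.
  by apply/val_inj; rewrite /= !inordK // leqW.
by have -> : lift ord0 (inord k : 'I_n.+1) = inord k.+1;
  first by apply/val_inj; rewrite /= !inordK.
Qed.

Lemma arg_ext n (x y : V ^ n.+1) :
  (forall k, (k <= n)%N -> arg x k = arg y k) -> x = y.
Proof.
by move=> xy; apply/ffunP => i; rewrite !argE; apply: xy; rewrite -ltnS.
Qed.

Lemma ffunI0 (x y : V ^ 0) : x = y.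
Proof. by apply/ffunP => -[]. Qed.

(** Disjoint merges commute; for [l = k.+1] the two sides differ by associativity of [op]. *)
Lemma args_merge_comm n (x : V ^ n.+2) k l : (k < l)%N ->
  args_merge_nat k (args_merge_nat l x) =
  args_merge_nat l.-1 (args_merge_nat k x).
Proof.
case: n x => [|n] x kl; first exact: ffunI0.
apply: arg_ext => p pn; rewrite !arg_merge //; try lia.
by do ![case: ifP => ?]; rewrite ?opA //; try lia.
Qed.

Lemma args_tail_merge0 n (x : V ^ n.+2) :
  args_tail (args_merge_nat 0 x) = args_tail (args_tail x).
Proof.
case: n x => [|n] x; first exact: ffunI0.
by apply: arg_ext => p pn; rewrite !(arg_tail, arg_merge) //; lia.
Qed.

Lemma args_tail_merge n (x : V ^ n.+2) k :
  args_tail (args_merge_nat k.+1 x) = args_merge_nat k (args_tail x).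
Proof.
case: n x => [|n] x; first exact: ffunI0.
by apply: arg_ext => p pn; rewrite !(arg_tail, arg_merge) //; lia.
Qed.

Lemma args_init_tail n (x : V ^ n.+2) :
  args_init (args_tail x) = args_tail (args_init x).
Proof.
case: n x => [|n] x; first exact: ffunI0.
by apply: arg_ext => p pn; rewrite !(arg_tail, arg_init) //; lia.
Qed.

Lemma args_init_merge n (x : V ^ n.+2) k : (k < n)%N ->
  args_init (args_merge_nat k x) = args_merge_nat k (args_init x).
Proof.
case: n x => [|n] x kn; first exact: ffunI0.
by apply: arg_ext => p pn; rewrite !(arg_init, arg_merge) //; lia.
Qed.

Lemma args_init_merge_last n (x : V ^ n.+2) :
  args_init (args_merge_nat n x) = args_init (args_init x).
Proof.
case: n x => [|n] x; first exact: ffunI0.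
apply: arg_ext => p pn; rewrite !(arg_init, arg_merge) //; try lia.
by rewrite ltnS pn.
Qed.

(** The cosimplicial identities. The pairs [(i, j)] = (0, 1) and (n+1, n+2) rest on [rhoM] and [mA],
    the pair (0, n+2) on [mA] alone, as left and right actions commute. All others are
    rearrangements of arguments. *)
Lemma coface_comm n (f : V ^ n -> W) x i j : (i < j <= n.+2)%N ->
  coface j (coface i f) x = coface i (coface j.-1 f) x.
Proof.
(* From here on the outer coface index is [j.+1]. *)
case: j => // j /andP[ij jn]; rewrite /coface /=.
have [i0|i0] := eqVneq i 0%N.
  have [-> /=|j0] := eqVneq j 0%N.
    by rewrite args_tail_merge0 !argE !arg_merge ?arg_tail //= rhoM mA.
  case: (ltnP j n.+1) => jn1.
    case: j j0 jn1 {ij jn} => // j _ jn1.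
    by rewrite -ltnS jn1 args_tail_merge !argE arg_merge.
  have -> : (j <= n)%N = false by lia.
  by rewrite mA args_init_tail !argE arg_tail ?arg_init.
have j0 : (j == 0%N) = false by lia.
rewrite j0; case: (ltnP j n.+1) => jn1.
  have -> : (i <= n)%N by lia.
  have -> : (i <= n.+1)%N by lia.
  by rewrite -ltnS jn1 args_merge_comm //; lia.
have -> : (j <= n)%N = false by lia.
have -> : (i <= n.+1)%N by lia.
have [i_n|i_n] := leqP i n.
  rewrite args_init_merge; last lia.
  rewrite !argE arg_merge //=; have -> : (n < i.-1)%N = false by lia.
  by have -> : (n == i.-1)%N = false by lia.
have -> : i.-1 = n by lia.
by rewrite args_init_merge_last !argE arg_merge ?arg_init //= ltnn eqxx rhoM mA.
Qed.

Lemma hochschildK n (f : V ^ n -> W) x : hochschild (hochschild f) x = 0.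
Proof.
rewrite hochschildE.
under eq_bigr => k _.
  rewrite (_ : coface k _ x = coface k
    (fun y => \sum_(i < n.+2) (-1) ^+ i *: coface i f y) x); last first.
    by congr (coface _ _ _); apply/funext => y; apply: hochschildE.
  rewrite coface_sum; over.
by apply: (alternating_double_sum0 (s := fun j i => coface j (coface i f) x))
  => i j; apply: coface_comm.
Qed.

End Hochschild.

(** * Sweedler sums under linear maps *)

Section Sweedler.
Variables (K : fieldType) (V W : lmodType K).

Lemma eq_sweedler (B B' : V -> V -> W) t :
  (forall y z, B y z = B' y z) -> sweedler B t = sweedler B' t.
Proof.
move=> BB'; congr (sweedler _ t).
by apply/funext => y; apply/funext => z; apply: BB'.
Qed.

(** By [tliftE], a Sweedler sum is a finite linear combination of values of [B], read off the chosen
    representative of [t]. *)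
Lemma linear_sweedler (W' : lmodType K) (g : {linear W -> W'})
    (B : V -> V -> W) t :
  g (\sw_(y, z <- t) B y z) = \sw_(y, z <- t) g (B y z).
Proof.
rewrite /sweedler !tliftE linear_sum; apply: eq_bigr => p _.
by rewrite linearZ.
Qed.

End Sweedler.

(** * The convolution algebra Hom(H, A) *)

Section Convolution.
Variables (K : fieldType) (H : bialgType K) (A : assocAlgType K).
Implicit Types f g h : {linear H -> A}.

Lemma amul_linear_bilinear f g :
  bilinear_for *:%R *:%R (fun y z => f y ** g z).
Proof.
have [Ml Mr] := @amul_bilinear K A.
by split=> [z a y y'|y a z z'] /=; rewrite linearP ?Ml ?Mr.
Qed.

Lemma convolution_is_linear f g :
  linear (fun x : H => \sw_(y, z <- comul x) (f y ** g z)).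
Proof.
move=> a x y; rewrite linearP.
exact: (sweedler_is_linear (amul_linear_bilinear f g)).
Qed.

Definition convolution f g : {linear H -> A} :=
  mk_linear (convolution_is_linear f g).

Lemma convolution_bilinear : bilinear_for *:%R *:%R convolution.
Proof.
have [Ml Mr] := @amul_bilinear K A.
split=> [g a f f'|f a g g']; apply: linear_ext => x; rewrite linE /=.
  by rewrite -sweedler_linear_fun; apply: eq_sweedler => y z; rewrite Ml.
by rewrite -sweedler_linear_fun; apply: eq_sweedler => y z; rewrite Mr.
Qed.

Lemma amul3_mlin f g h :
  multilinear (fun p : H ^ 3 => f (p ord0) ** g (p (inord 1)) ** h (p ord_max)).
Proof.
have [Ml Mr] := @amul_bilinear K A.
move=> i p a u v; rewrite !ffunE -!(inj_eq val_inj) /= !inordK //.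
case: i => [[|[|[|//]]] ?] /=; rewrite linearP.
- by rewrite Ml Ml.
- by rewrite Mr Ml.
- by rewrite Mr.
Qed.

(** The map [T] induced on the third tensor power by the triple product sends the two sides of
    coassociativity to the two bracketings. *)
Lemma convolutionA : associative convolution.
Proof.
have [Ml Mr] := @amul_bilinear K A.
move=> f g h; apply: linear_ext => x /=.
pose T := tlin (amul3_mlin f g h).
have TE y z w : T (tens [tuple y; z; w]) = f y ** g z ** h w.
  rewrite /T /tens tlin_pure !ffunE; congr (f _ ** g _ ** h _).
  by rewrite (tnth_nth 0) /= inordK.
transitivity (T (\sw_(y, z <- comul x) \sw_(z1, z2 <- comul z)
                   tens [tuple y; z1; z2])).
  rewrite linear_sweedler; apply: eq_sweedler => y z.
  rewrite linear_sweedler.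
  apply: etrans (linear_sweedler (mk_linear (Mr (f y))) _ _) _.
  by apply: eq_sweedler => z1 z2; rewrite TE /= amulA.
rewrite -comul_coassoc linear_sweedler; apply: eq_sweedler => y z.
rewrite linear_sweedler.
apply/esym; apply: etrans (linear_sweedler (mk_linear (Ml (h z))) _ _) _.
by apply: eq_sweedler => y1 y2; rewrite TE.
Qed.

Variable lambda : module_algebra H A.

Lemma act_at_is_linear (a : A) : linear (fun x => lambda x a).
Proof. by move=> c x y; rewrite linearP. Qed.

Definition act_at (a : A) : {linear H -> A} := mk_linear (act_at_is_linear a).

Lemma act_atM : {morph act_at : a b / a ** b >-> convolution a b}.
Proof. by move=> a b; apply: linear_ext => x; apply: act_amul. Qed.

Lemma act_atD a b : act_at (a + b) = act_at a + act_at b.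
Proof. by apply: linear_ext => x; rewrite linE /= linearD. Qed.

End Convolution.

(** * The differentials as Hochschild coboundaries *)

Section Differential.
Variables (K : fieldType) (H : bialgType K) (A : assocAlgType K).
Variable lambda : module_algebra H A.

Lemma lin_compA (U : lmodType K) : associative (@lin_comp K U U U).
Proof. by move=> f g h; apply: linear_ext. Qed.

Lemma d0_pure n (phi : cochain0 H A n) x :
  d0 lambda n phi (tpure x) =
  hochschild *%R (@lin_comp K A A A) lambda (fun y => phi (tpure y)) x.
Proof. exact: tlin_pure. Qed.

Lemma d0K n (phi : cochain0 H A n) : d0 lambda n.+1 (d0 lambda n phi) = 0.
Proof.
apply: tpow_ext => x; rewrite d0_pure.
rewrite (_ : (fun y => _) =
  hochschild *%R (@lin_comp K A A A) lambda (fun y => phi (tpure y))).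
  apply: hochschildK; [exact: mulrA | exact: lin_compA |
    exact: lin_comp_bilinear | exact: actM].
by apply/funext => y; apply: d0_pure.
Qed.

Section FirstCochain.
Variables (n : nat) (phi : cochain1 H A n).

Lemma eval_pure_is_linear (a : A ^ n) : linear (fun x => phi x (tpure a)).
Proof. by move=> c x y; rewrite linearP. Qed.

(** Exchanging the two arguments turns [phi] into a cochain on [A] with values in the convolution
    algebra. *)
Definition eval_pure (a : A ^ n) : {linear H -> A} :=
  mk_linear (eval_pure_is_linear a).

End FirstCochain.

Lemma eval_pure_d1 n (phi : cochain1 H A n) a :
  eval_pure (d1 lambda n phi) a =
  hochschild (@amul K A) (@convolution K H A) (act_at lambda) (eval_pure phi) a.
Proof.
apply: linear_ext => x; rewrite [LHS]tlin_pure /hochschild !linE.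
congr (_ + _ + _).
(* The outer terms agree by conversion; in the middle one, evaluation at [x] is moved inside the
   sum. *)
by apply/esym; apply: (big_morph (fun f : {linear H -> A} => f x)).
Qed.

Lemma cochain1_ext n (phi psi : cochain1 H A n) :
  eval_pure phi =1 eval_pure psi -> phi = psi.
Proof.
move=> E; apply: linear_ext => x; apply: tpow_ext => a.
exact: (congr1 (fun g : {linear H -> A} => g x) (E a)).
Qed.

Lemma eval_pure0 n a : eval_pure (0 : cochain1 H A n) a = 0.
Proof. exact: linear_ext. Qed.

Lemma d1K n (phi : cochain1 H A n) : d1 lambda n.+1 (d1 lambda n phi) = 0.
Proof.
apply: cochain1_ext => a; rewrite eval_pure0 eval_pure_d1.
rewrite (funext (eval_pure_d1 phi)); apply: hochschildK.
- exact: amulA.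
- exact: convolutionA.
- exact: convolution_bilinear.
- exact: act_atM.
Qed.

(** * Degree zero: derivations *)

Lemma d0_dDer (phi : Der A) :
  d0 lambda 1 (cochain1to0 H A (dDer lambda phi)) = 0.
Proof.
apply: tpow_ext => x; rewrite d0_pure.
rewrite (_ : (fun y => _) =
  hochschild *%R (@lin_comp K A A A) lambda
    (fun _ : H ^ 0 => der_val phi)).
  apply: hochschildK; [exact: mulrA | exact: lin_compA |
    exact: lin_comp_bilinear | exact: actM].
apply/funext => y; rewrite /= tlift_pure; last exact: coord0_mlin.
(* For a 0-cochain the middle sum is empty and the last sign is -1, which leaves the commutator with
   [phi]. *)
rewrite /hochschild big_ord0 addr0 expr1 scaleN1r /dDer_fun.
by rewrite (ord1 ord_max).
Qed.

Lemma eval_pure_dDer (phi : Der A) a :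
  eval_pure (cochain1to1 H A (dDer lambda phi)) a =
  act_at lambda (phi (a ord0)) - lin_comp phi (act_at lambda (a ord0)).
Proof.
apply: linear_ext => x; rewrite !linE /= tlift_pure //.
exact: coord0_mlin.
Qed.

(** Composition with [phi] is thus a derivation of the convolution algebra: apply [phi] under the
    Sweedler sum. *)
Lemma derivation_convolution (phi : Der A) (f g : {linear H -> A}) :
  lin_comp phi (convolution f g) =
  convolution f (lin_comp phi g) + convolution (lin_comp phi f) g.
Proof.
have phiD : is_derivation phi by case: phi => phi phiD; apply/asboolP.
apply: linear_ext => x; rewrite linE /= linear_sweedler.
(* The coefficient 1 gives the summand the form that [sweedler_linear_fun] expects. *)
under eq_sweedler => y z do rewrite phiD -[X in X + _]scale1r.
by rewrite sweedler_linear_fun scale1r.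
Qed.

(** Both [act_at (phi a)] and [phi] composed with [act_at a] obey the Leibniz rule along [act_at],
    so their difference is a 1-cocycle. *)
Lemma d1_dDer (phi : Der A) :
  d1 lambda 1 (cochain1to1 H A (dDer lambda phi)) = 0.
Proof.
have [Cl Cr] := @convolution_bilinear K H A.
have ClB (f g h : {linear H -> A}) : convolution (f - g) h = convolution f h - convolution g h.
  by rewrite -scaleN1r addrC Cl /= scaleN1r addrC.
have CrB (f g h : {linear H -> A}) : convolution h (f - g) = convolution h f - convolution h g.
  by rewrite -scaleN1r addrC Cr /= scaleN1r addrC.
have phiD : is_derivation phi by case: phi => phi phiD; apply/asboolP.
apply: cochain1_ext => a; rewrite eval_pure0 eval_pure_d1 /hochschild.
rewrite big_ord1 !eval_pure_dDer !ffunE /=.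
rewrite (_ : widen_ord _ ord0 = ord0); last exact: val_inj.
rewrite (_ : lift ord0 ord0 = ord_max); last exact: val_inj.
rewrite expr1 expr2 mulN1r opprK scaleN1r scale1r phiD.
rewrite act_atD !act_atM derivation_convolution ClB CrB.
set p := convolution _ _; set q := convolution _ _.
set r := convolution _ _; set s := convolution _ _.
(* What remains is [p - q - ((p + r) - (q + s)) + (r - s) = 0]. *)
by rewrite opprB addrAC [p - q + _]addrACA -opprD addrA subrK subrr.
Qed.

End Differential.

(** * Assembly of the two components *)

Theorem proposition2p5 (K : fieldType) (H : bialgType K) (A : assocAlgType K)
    (lambda : module_algebra H A) (n : nat) :
  lin_comp (diff lambda n.+1) (diff lambda n) = 0.
Proof.
(* The cases [n = 0], [n = 1] and [n >= 2] follow the clauses of [diff]; in each, the two components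
   vanish separately. *)
apply: linear_ext => phi; case: n phi => [|[|n]] phi; rewrite linE /=.
- by rewrite [X in (X, _)]d0_dDer [X in (_, X)]d1_dDer.
- by rewrite [X in (X, _)]d0K [X in (_, X)]d1K.
- by rewrite [X in (X, _)]d0K [X in (_, X)]d1K.
Qed.
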